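(* Let $W^B$ be a channel from a finite set $\mathcal X$ to a finite set $\mathcal Y$ and $W^E$ a channel from $\mathcal X$ to a finite set $\mathcal Z$, and consider their $n$-fold memoryless extensions $W^{B,n},W^{E,n}$. For any nonnegative reals $R,R'$ and any probability distribution $p$ on $\mathcal X$, there exists a sequence $\{\Phi_n\}$ of wire-tap codes for $(W^{B,n},W^{E,n})$ such that $\lim_n\frac1n\log|\Phi_n|=R$ and $$\liminf_n-\tfrac1n\log\epsilon_B(\Phi_n)\ge\max_{0\le s\le1}\{-\phi(s|W^B,p)-s(R+R')\},$$ $$\liminf_n-\tfrac1n\log I_E(\Phi_n)\ge\max_{-1/2\le t\le0}\{-\phi(t|W^E,p)-tR'\},$$ $$\liminf_n-\tfrac1n\log d_E(\Phi_n)\ge\max_{0\le s\le1}\frac{-\psi(s|W^E,p)+sR'}{1+s},$$ $$\liminf_n-\tfrac1n\log d_E(\Phi_n)\ge\tfrac12\max_{-1/2\le t\le0}\{-\phi(t|W^E,p)-tR'\}.$$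
   Context: A channel $W$ assigns to each input $x$ a distribution $W_x$ on the output set; $W_p(y)=\sum_xp(x)W_x(y)$; the $n$-fold memoryless extension is $W^n_{x^n}(y^n)=\prod_iW_{x_i}(y_i)$. A wire-tap code $\Phi=(M,\{Q_i\},\{\mathcal D_i\})$ for $(W^B,W^E)$: input distributions $Q_1,\dots,Q_M$ and pairwise disjoint subsets $\mathcal D_i$ of the main receiver's output set; $|\Phi|=M$, $\epsilon_B(\Phi)=\frac1M\sum_iW^B_{Q_i}(\mathcal D_i^c)$, $I_E(\Phi)=\sum_i\frac1MD(W^E_{Q_i}\|W^E_\Phi)$ with $W^E_\Phi=\frac1M\sum_iW^E_{Q_i}$ and $D(a\|b)=\sum a\log(a/b)$, $d_E(\Phi)=\frac1{M(M-1)}\sum_{i\ne j}\sum_z|W^E_{Q_i}(z)-W^E_{Q_j}(z)|$. Functions: $\phi(t|W,p):=\log\sum_y\big(\sum_xp(x)W_x(y)^{1/(1+t)}\big)^{1+t}$; $\psi(s|W,p):=\log\sum_xp(x)\sum_yW_x(y)^{1+s}W_p(y)^{-s}$. *)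

(* Defs.v *)
From mathcomp Require Import all_boot all_order all_algebra.
From mathcomp Require Import all_classical all_reals all_analysis.
Set Implicit Arguments. Unset Strict Implicit. Unset Printing Implicit Defensive.
Import Order.TTheory GRing.Theory Num.Theory.
Local Open Scope ring_scope.

Section WireTap.
Variable R : realType.

Definition is_distr (A : finType) (p : A -> R) :=
  (forall a, 0 <= p a) /\ \sum_a p a = 1.

Definition is_channel (A B : finType) (W : A -> B -> R) :=
  forall a, is_distr (W a).

Definition chan_out (A B : finType) (W : A -> B -> R) (p : A -> R) (b : B) : R :=
  \sum_a p a * W a b.

Definition ext_chan (n : nat) (A B : finType) (W : A -> B -> R)
  (x : {ffun 'I_n -> A}) (y : {ffun 'I_n -> B}) : R :=
  \prod_(i < n) W (x i) (y i).

(* a wire-tap code: M messages, input distributions Q i, decoding sets D i *)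
Record wcode (A B : finType) := WCode {
  wc_M : nat;
  wc_Q : 'I_wc_M -> A -> R;
  wc_D : 'I_wc_M -> {set B} }.
Arguments wc_M {A B} w : rename.
Arguments wc_Q {A B} w _ _ : rename.
Arguments wc_D {A B} w _ : rename.

Definition is_wcode (A B : finType) (c : wcode A B) :=
  (0 < wc_M c)%N /\
  (forall i, is_distr (wc_Q c i)) /\
  (forall i j, i != j -> [disjoint wc_D c i & wc_D c j]).

Definition eps_B (A B : finType) (WB : A -> B -> R) (c : wcode A B) : R :=
  (wc_M c)%:R^-1 *
  \sum_(i < wc_M c) \sum_(b in ~: wc_D c i) chan_out WB (wc_Q c i) b.

Definition rel_ent (C : finType) (a b : C -> R) : R :=
  \sum_z (if a z == 0 then 0 else a z * ln (a z / b z)).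

Definition code_out (A B C : finType) (WE : A -> C -> R) (c : wcode A B) (z : C) : R :=
  (wc_M c)%:R^-1 * \sum_(i < wc_M c) chan_out WE (wc_Q c i) z.

Definition I_E (A B C : finType) (WE : A -> C -> R) (c : wcode A B) : R :=
  \sum_(i < wc_M c) (wc_M c)%:R^-1 *
     rel_ent (chan_out WE (wc_Q c i)) (code_out WE c).

Definition d_E (A B C : finType) (WE : A -> C -> R) (c : wcode A B) : R :=
  ((wc_M c)%:R * ((wc_M c)%:R - 1))^-1 *
  \sum_(i < wc_M c) \sum_(j < wc_M c | i != j) \sum_z
     `|chan_out WE (wc_Q c i) z - chan_out WE (wc_Q c j) z|.

Definition phiF (A B : finType) (W : A -> B -> R) (p : A -> R) (t : R) : R :=
  ln (\sum_b (powR (\sum_a p a * powR (W a b) (1 + t)^-1) (1 + t))).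

Definition psiF (A B : finType) (W : A -> B -> R) (p : A -> R) (s : R) : R :=
  ln (\sum_a p a * \sum_b (powR (W a b) (1 + s) * powR (chan_out W p b) (- s))).

Definition neglog_rate (x : nat -> R) (n : nat) : \bar R :=
  if x n == 0 then +oo%E else (- ln (x n) / n%:R)%:E.

End WireTap.

(* Main.v *)
Require Import Defs.
From mathcomp Require Import all_boot all_order all_algebra.
From mathcomp Require Import all_classical all_reals all_analysis.
From mathcomp Require Import ring lra.
Import Order.TTheory GRing.Theory Num.Theory.
Import numFieldNormedType.Exports.
Local Open Scope ring_scope.
Local Open Scope classical_set_scope.
Set Implicit Arguments. Unset Strict Implicit. Unset Printing Implicit Defensive.

(** Random coding.  Draw [M * L] codewords independently from [p], send message
    [i] as a uniformly chosen codeword of row [i], and decode by maximum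
    likelihood; at block length [n], [M] is about [exp (n R)] and [L] about
    [exp (n R')].  Only pairwise independence of the codewords is used: Jensen's
    inequality for the concave functions [x ^ s] and [ln] is applied in the form
    of the tangent line inequality, whose mean is computed term by term.
    - [eps_B]: Gallager's bound, with mean at most [(M L)^s exp (phi s)].
    - [I_E]: the information is at most the mean divergence to the output law
      [W_p], whose mean is at most [L^(-s) exp (psi s) / s], and
      [psi s <= phi (-s)] by Hoelder's inequality.  The endpoint [t = 0] follows
      from [I_E <= ln M].
    - [d_E]: truncating [W_x / W_p] and bounding one part in mean and the other
      in variance gives [6 (L^(-s) exp (psi s))^(1 / (1 + s))].  Since this
      exponent is at least half the one of [I_E] whenever the latter is positive,
      the fourth bound follows from the third.
    The mean of each quantity is bounded for all [s] at once, hence a single code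
    which is within a factor [3] of the three means satisfies all the bounds. *)

(** * Elementary inequalities for powers and logarithms *)

(** Young's inequality for [x ^ s] and [1] with exponents [1 / s] and [1 / (1 - s)]; the endpoints
    are apart because one exponent would be infinite. *)
Lemma powR_le_affine (R : realType) (x s : R) :
  0 <= x -> 0 <= s <= 1 -> x `^ s <= 1 - s + s * x.
Proof.
move=> x0 /andP[s0 s1].
have [->|s_neq0] := eqVneq s 0; first by rewrite powRr0; lra.
have [->|s_neq1] := eqVneq s 1; first by rewrite powRr1 //; lra.
have sgt0 : 0 < s by rewrite lt_neqAle eq_sym s_neq0.
have slt1 : 0 < 1 - s by rewrite subr_gt0 lt_neqAle s_neq1.
have pq : (s^-1)^-1 + ((1 - s)^-1)^-1 = 1 :> R by rewrite !invrK; lra.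
have := @conjugate_powR R (x `^ s) 1 s^-1 (1 - s)^-1 (powR_ge0 _ _) ler01.
rewrite !invr_gt0 => /(_ sgt0 slt1 pq).
rewrite -powRrM divff // powRr1 // powR1 !invrK mulr1 mul1r; lra.
Qed.

(** Concavity at the point [c], by scaling from [c = 1]. The bound is affine in [x], so its mean
    only involves the mean of [x]. *)
Lemma powR_le_tangent (R : realType) (x c s : R) :
  0 <= x -> 0 < c -> 0 <= s <= 1 ->
  x `^ s <= c `^ s * (1 - s + s * (x / c)).
Proof.
move=> x0 c0 s01.
have xc0 : 0 <= x / c by rewrite divr_ge0 // ltW.
rewrite -{1}(divfK (lt0r_neq0 c0) x) powRM ?(ltW c0)// mulrC.
by rewrite ler_wpM2l ?powR_ge0 // powR_le_affine.
Qed.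

(** Weighted arithmetic-geometric mean inequality: the tangent of [b ^ s] at [b = a], times
    [a ^ (1 - s)]. *)
Lemma powRM_le_convex (R : realType) (a b s : R) :
  0 <= a -> 0 <= b -> 0 < s < 1 ->
  a `^ (1 - s) * b `^ s <= (1 - s) * a + s * b.
Proof.
move=> a0 b0 /andP[s0 s1].
have [->|an0] := eqVneq a 0.
  by rewrite powR0 ?mul0r ?mulr0 ?add0r ?mulr_ge0 ?(ltW s0)//; lra.
have ap : 0 < a by rewrite lt_neqAle eq_sym an0.
have s01 : 0 <= s <= 1 by rewrite !ltW.
have := powR_le_tangent b0 ap s01.
move/(ler_wpM2l (powR_ge0 a (1 - s))) => /le_trans; apply.
rewrite (mulrA (a `^ _)) -powRD ?an0 ?implybT// subrK powRr1//.
by rewrite le_eqVlt; apply/orP; left; apply/eqP; field; rewrite an0.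
Qed.

Lemma ln_le_tangent (R : realType) (x c : R) :
  0 < x -> 0 < c -> ln x <= ln c + x / c - 1.
Proof.
move=> x0 c0; have xc : 0 < x / c by rewrite divr_gt0.
have : ln (1 + (x / c - 1)) <= x / c - 1 by apply: le_ln1Dx; lra.
by rewrite addrC subrK ln_div ?posrE //; lra.
Qed.

(** As [s * ln (1 + v) = ln ((1 + v) ^ s)], subadditivity of [x ^ s] suffices. This turns a
    logarithm into a moment. *)
Lemma ln1D_le_powR (R : realType) (v s : R) :
  0 <= v -> 0 < s <= 1 -> ln (1 + v) <= v `^ s / s.
Proof.
move=> v0 /andP[s0 s1].
have v1 : 0 < 1 + v by lra.
rewrite ler_pdivlMr // mulrC -ln_powR.
suff h : (1 + v) `^ s <= 1 + v `^ s.
  apply: le_trans (le_ln1Dx _); last first.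
    by rewrite (lt_le_trans _ (powR_ge0 v s)) // ltrN10.
  by rewrite ler_ln ?posrE ?powR_gt0// ltr_wpDr ?powR_ge0.
have bnd (x : R) : 0 <= x <= 1 -> x <= x `^ s.
  case/andP; rewrite le_eqVlt => /orP[/eqP <- _|x0 x1]; first exact: powR_ge0.
  by apply: ger1_powR; rewrite // x0.
(* The fractions [1 / (1 + v)] and [v / (1 + v)] sum to [1], and each is at most its own power
   [s]. *)
have h1 : 1 <= (1 + v)^-1 `^ s + (v / (1 + v)) `^ s.
  have {1}-> : (1 : R) = (1 + v)^-1 + v / (1 + v).
    by field; rewrite gt_eqF.
  have vv : 0 <= (1 + v)^-1 by rewrite invr_ge0 ltW.
  apply: lerD; apply: bnd.
    by rewrite vv invf_le1 //; lra.
  by rewrite mulr_ge0 //= ler_pdivrMr //; lra.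
move/(ler_wpM2l (powR_ge0 (1 + v) s)): h1.
rewrite mulr1 mulrDr -!powRM ?invr_ge0 ?(ltW v1)//; last first.
  by rewrite mulr_ge0 ?invr_ge0 ?(ltW v1).
by rewrite divff ?gt_eqF // powR1 mulrCA divff ?gt_eqF // mulr1.
Qed.

(** A substitute for the Cauchy-Schwarz bound on a mean absolute value, linear in [x ^ 2], with a
    free scale [k]. *)
Lemma norm_le_sqr (R : realType) (x k : R) :
  0 < k -> `|x| <= x ^+ 2 / (2 * k) + k / 2.
Proof.
move=> k0; rewrite -subr_ge0 -(real_normK (num_real x)).
have -> : `|x| ^+ 2 / (2 * k) + k / 2 - `|x| = (`|x| - k) ^+ 2 / (2 * k).
  by field; lra.
by rewrite divr_ge0 ?sqr_ge0//; lra.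
Qed.

(** Markov's inequality for three functions at once: the sum of the functions divided by their means
    has mean at most [3], so it is at most [3] at some point of positive weight, and so is each
    nonnegative term. *)
Lemma exists_le3_expect (R : realType) (C : finType) (P f g h : C -> R) :
  is_distr P -> (forall c, 0 <= f c) -> (forall c, 0 <= g c) ->
  (forall c, 0 <= h c) ->
  exists c, [/\ 0 < P c, f c <= 3 * \sum_c P c * f c,
    g c <= 3 * \sum_c P c * g c & h c <= 3 * \sum_c P c * h c].
Proof.
move=> [P0 P1] f0 g0 h0.
pose E (u : C -> R) := \sum_c P c * u c.
have E0 u : (forall c, 0 <= u c) -> 0 <= E u.
  by move=> u0; apply: sumr_ge0 => c _; rewrite mulr_ge0.
pose F c := f c / E f + g c / E g + h c / E h.
have EF : E F <= 3.
  have -> : E F = E f / E f + E g / E g + E h / E h.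
    rewrite /E !mulr_suml -!big_split /=; apply: eq_bigr => c _.
    by rewrite /F /E !mulrDr !mulrA.
  (* As [0 / 0 = 0], a function of mean zero contributes [0] instead of [1]. *)
  have le1 (x : R) : x / x <= 1.
    by have [->|/divff ->//] := eqVneq x 0; rewrite mul0r ler01.
  by have := le1 (E f); have := le1 (E g); have := le1 (E h); lra.
have [c Pc Fc] : exists2 c, 0 < P c & F c <= 3.
  apply: contrapT => H.
  have HF c : 0 < P c -> 3 < F c.
    by move=> Pc; rewrite ltNge; apply/negP => Fc; apply: H; exists c.
  have leE : 3 <= E F.
    have -> : 3 = \sum_c P c * 3 :> R by rewrite -mulr_suml P1 mul1r.
    apply: ler_sum => c _.
    have := P0 c; rewrite le_eqVlt => /orP[/eqP <-|Pc]; first by rewrite !mul0r.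
    by rewrite ler_wpM2l ?P0 // ltW // HF.
  have nn c : true -> 0 <= P c * (F c - 3).
    move=> _; have := P0 c; rewrite le_eqVlt => /orP[/eqP <-|Pc].
      by rewrite mul0r.
    by rewrite mulr_ge0 ?P0// subr_ge0 ltW // HF.
  have : \sum_c P c * (F c - 3) = 0.
    under eq_bigr do rewrite mulrBr.
    rewrite sumrB -mulr_suml P1 mul1r; apply/eqP; rewrite subr_eq0.
    by rewrite eq_le EF leE.
  move/(psumr_eq0P nn) => Z.
  suff : \sum_c P c = 0 by move/eqP; rewrite P1 oner_eq0.
  apply: big1 => c _; apply/eqP; apply/negP => /negP Pc.
  have {}Pc : 0 < P c by rewrite lt_neqAle eq_sym Pc P0.
  have /eqP := Z c isT; rewrite mulf_eq0 gt_eqF //= subr_eq0.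
  by rewrite gt_eqF ?HF.
have key u : (forall c, 0 <= u c) -> u c / E u <= 3 -> u c <= 3 * E u.
  move=> u0 uc; have := E0 _ u0; rewrite le_eqVlt => /orP[/eqP Eu|Eu]; last first.
    by rewrite -ler_pdivrMr.
  (* When the mean is zero, a positive value at a point of positive weight is a contradiction. *)
  rewrite -Eu mulr0; apply: contraT; rewrite -ltNge => uc0.
  have : P c * u c <= E u.
    rewrite /E (bigD1 c) //= lerDl; apply: sumr_ge0 => i _.
    by rewrite mulr_ge0.
  by rewrite -Eu leNgt mulr_gt0.
have q0 u : (forall c, 0 <= u c) -> 0 <= u c / E u.
  by move=> u0; rewrite divr_ge0 // E0.
have := q0 _ f0; have := q0 _ g0; have := q0 _ h0.
exists c; split => //; apply: key => //; move: Fc; rewrite /F; lra.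
Qed.

(** * Random codebooks with independent codewords *)

(** Besides the law of a codebook, this is, for [K = 'I_n], the product distribution on input words
    of length [n]. *)
Definition code_prob (R : realType) (A K : finType) (p : A -> R)
  (c : {ffun K -> A}) : R := \prod_k p (c k).

Definition code_mean (R : realType) (A K : finType) (p : A -> R)
  (f : {ffun K -> A} -> R) : R := \sum_c code_prob p c * f c.

Section CodeMean.
Variables (R : realType) (A K : finType) (p : A -> R).
Hypothesis hp : is_distr p.
Local Notation E := (@code_mean R A K p).
Implicit Types (c : {ffun K -> A}) (f g : A -> R).

Lemma code_prob_ge0 c : 0 <= code_prob p c.
Proof. by apply: prodr_ge0 => k _; case: hp. Qed.

Lemma code_prob_distr : is_distr (@code_prob R A K p).
Proof.
split=> [c|]; first exact: code_prob_ge0.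
rewrite /code_prob -(bigA_distr_bigA (fun _ : K => p)) /=.
by apply: big1 => k _; case: hp.
Qed.

Lemma code_prob_supp c k : 0 < code_prob p c -> 0 < p (c k).
Proof.
move=> Pc; have [p0 _] := hp; rewrite lt_neqAle p0 andbT eq_sym.
apply/eqP => pk; move: Pc; rewrite /code_prob (bigD1 k) //= pk mul0r.
by rewrite ltxx.
Qed.

(** Null codebooks are discarded here, so that every codeword may be taken in the support of [p]. *)
Lemma ler_code_mean (F G : {ffun K -> A} -> R) :
  (forall c, 0 < code_prob p c -> F c <= G c) -> E F <= E G.
Proof.
move=> FG; apply: ler_sum => c _.
have := code_prob_ge0 c; rewrite le_eqVlt => /orP[/eqP <-|Pc].
  by rewrite !mul0r.
by rewrite ler_pM2l // FG.
Qed.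

Lemma eq_code_mean (F G : {ffun K -> A} -> R) : F =1 G -> E F = E G.
Proof. by move=> FG; apply: eq_bigr => c _; rewrite FG. Qed.

Lemma code_meanD (F G : {ffun K -> A} -> R) :
  E (fun c => F c + G c) = E F + E G.
Proof. by rewrite /code_mean -big_split; apply: eq_bigr => c _; rewrite mulrDr. Qed.

Lemma code_meanZ (a : R) (F : {ffun K -> A} -> R) :
  E (fun c => a * F c) = a * E F.
Proof. by rewrite /code_mean mulr_sumr; apply: eq_bigr => c _; rewrite mulrCA. Qed.

Lemma code_mean_sum (I : finType) (Q : pred I) (F : I -> {ffun K -> A} -> R) :
  E (fun c => \sum_(i | Q i) F i c) = \sum_(i | Q i) E (F i).
Proof.
rewrite /code_mean exchange_big; apply: eq_bigr => c _.
by rewrite mulr_sumr.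
Qed.

Lemma code_mean_cst (a : R) : E (fun=> a) = a.
Proof. by rewrite /code_mean -mulr_suml; case: code_prob_distr => _ ->; rewrite mul1r. Qed.

(** The integrand is a product over all positions, with factor [1] off [k] and [l]. Distributivity
    factors the sum, and each other position gives the total mass [1]. *)
Lemma code_mean_pair f g k l : k != l ->
  E (fun c => f (c k) * g (c l)) = (\sum_a p a * f a) * (\sum_a p a * g a).
Proof.
move=> kl.
pose F j a := p a * (if j == k then f a else 1) * (if j == l then g a else 1).
transitivity (\sum_(c : {ffun K -> A}) \prod_j F j (c j)).
  apply: eq_bigr => c _; rewrite /F !big_split /= -mulrA; congr (_ * (_ * _)).
    by rewrite -big_mkcond big_pred1_eq.
  by rewrite -big_mkcond big_pred1_eq.
rewrite -(bigA_distr_bigA F) (bigD1 k) //= (bigD1 l) //=; last by rewrite eq_sym.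
rewrite [X in _ * (_ * X)]big1 ?mulr1; last first.
  move=> j /andP[jk jl]; rewrite -[RHS](proj2 hp); apply: eq_bigr => a _.
  by rewrite /F (negbTE jk) (negbTE jl) !mulr1.
congr (_ * _); apply: eq_bigr => a _; rewrite /F eqxx.
  by rewrite (negbTE kl) mulr1.
by rewrite eq_sym (negbTE kl) mulr1.
Qed.

Lemma code_mean_single f k : E (fun c => f (c k)) = \sum_a p a * f a.
Proof.
pose F j a := p a * (if j == k then f a else 1).
transitivity (\sum_(c : {ffun K -> A}) \prod_j F j (c j)).
  apply: eq_bigr => c _; rewrite /F !big_split /=; congr (_ * _).
  by rewrite -big_mkcond big_pred1_eq.
rewrite -(bigA_distr_bigA F) (bigD1 k) //= [X in _ * X]big1 ?mulr1; last first.
  move=> j jk; rewrite -[RHS](proj2 hp); apply: eq_bigr => a _.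
  by rewrite /F (negbTE jk) !mulr1.
by apply: eq_bigr => a _; rewrite /F eqxx.
Qed.

Lemma code_mean_centered f g k l : k != l -> \sum_a p a * g a = 0 ->
  E (fun c => f (c k) * g (c l)) = 0.
Proof. by move=> kl g0; rewrite code_mean_pair // g0 mulr0. Qed.

Lemma sum_distr_centered f : \sum_a p a * (f a - \sum_b p b * f b) = 0.
Proof.
under eq_bigr do rewrite mulrBr.
by rewrite sumrB -mulr_suml (proj2 hp) mul1r subrr.
Qed.

Lemma code_prob_null f c k : (forall a, 0 <= f a) -> \sum_a p a * f a = 0 ->
  0 < code_prob p c -> f (c k) = 0.
Proof.
move=> f0 + Pc; have [p0 _] := hp.
move/(psumr_eq0P (fun a _ => mulr_ge0 (p0 a) (f0 a))) => /(_ (c k) isT)/eqP.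
by rewrite mulf_eq0 gt_eqF ?code_prob_supp //= => /eqP.
Qed.

End CodeMean.

(** * Moment bounds for sums and averages over codewords *)

Section CodeMoments.
Variables (R : realType) (A K : finType) (p : A -> R).
Hypothesis hp : is_distr p.
Variable f : A -> R.
Hypothesis f_ge0 : forall a, 0 <= f a.
Local Notation E := (@code_mean R A K p).
Local Notation w := (\sum_a p a * f a).

Lemma distr_mean_ge0 : 0 <= w.
Proof. by apply: sumr_ge0 => a _; rewrite mulr_ge0 //; case: hp. Qed.

(** Tangent of [x ^ s] at [#|K| * w]; by pairwise independence each cross term has mean [w ^ 2]. *)
Lemma code_mean_mul_powR_sum (k : K) (s : R) : 0 <= s <= 1 ->
  E (fun c => f (c k) * (\sum_(l | l != k) f (c l)) `^ s) <=
  w * (#|K|%:R * w) `^ s.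
Proof.
move=> s01; have /andP[s0 s1] := s01.
have := distr_mean_ge0; rewrite le_eqVlt => /orP[/eqP w0|w0].
  rewrite -w0 mul0r -[leRHS](code_mean_cst K hp); apply: ler_code_mean => // c Pc.
  by rewrite (code_prob_null hp _ f_ge0 _ Pc) ?mul0r.
have K0 : 0 < #|K|%:R :> R by rewrite ltr0n; apply/card_gt0P; exists k.
set C := #|K|%:R * w; have C0 : 0 < C by rewrite mulr_gt0.
pose G (c : {ffun K -> A}) := C `^ s * (1 - s) * f (c k)
  + C `^ s * s / C * \sum_(l | l != k) f (c k) * f (c l).
apply: (@le_trans _ _ (E G)).
  apply: ler_code_mean => // c _.
  have U0 : 0 <= \sum_(l | l != k) f (c l) by apply: sumr_ge0.
  apply: le_trans (ler_wpM2l (f_ge0 _) (powR_le_tangent U0 C0 s01)) _.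
  rewrite /G -mulr_sumr le_eqVlt; apply/orP; left; apply/eqP.
  by field; rewrite gt_eqF.
rewrite /G code_meanD !code_meanZ code_mean_sum code_mean_single //.
rewrite [X in _ + _ * X](eq_bigr (fun=> w * w)); last first.
  by move=> l lk; apply: (code_mean_pair hp f f); rewrite eq_sym.
rewrite sumr_const -[w * w *+ _]mulr_natr.
(* Counting [#|K|] cross terms instead of [#|K| - 1] turns the tangent bound into the claim. *)
have nK : #|[pred l | l != k]|%:R <= #|K|%:R :> R by rewrite ler_nat max_card.
have -> : w * C `^ s = C `^ s * (1 - s) * w + C `^ s * s / C * (w * w * #|K|%:R).
  by rewrite /C; field; rewrite !gt_eqF.
rewrite lerD2l; apply: ler_wpM2l.
  apply: divr_ge0; last exact: ltW.
  by apply: mulr_ge0 => //; exact: powR_ge0.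
by apply: ler_wpM2l => //; rewrite mulr_ge0 ?ltW.
Qed.

Variables (L : nat) (J : 'I_L -> K).
Hypothesis J_inj : injective J.
Local Notation avg c := (L%:R^-1 * \sum_j f (c (J j))).

(** The tangent of [ln] is taken at a point that depends on the codeword [J j] only. What remains is
    linear and centered in the other codewords, hence of mean zero by pairwise independence. *)
Lemma code_mean_mul_ln_avg (j : 'I_L) : 0 < w ->
  E (fun c => f (c (J j)) * ln (avg c / w)) <=
  \sum_a p a * (f a * ln (1 + f a / (L%:R * w))).
Proof.
move=> w0; have L0 : 0 < L%:R :> R by rewrite ltr0n (leq_ltn_trans _ (ltn_ord j)).
have Lw0 : 0 < L%:R * w by rewrite mulr_gt0.
(* The conditional mean of [avg / w] given the codeword [J j], increased by [1 / L] for a simpler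
   form. *)
pose d a := 1 + f a / (L%:R * w).
have d1 a : 1 <= d a by rewrite lerDl divr_ge0 ?f_ge0 // ltW.
have d0 a : 0 < d a by apply: lt_le_trans (d1 a).
pose h a := f a / d a / (L%:R * w).
have h0 a : 0 <= h a by rewrite !divr_ge0 ?f_ge0 // ltW.
pose G (c : {ffun K -> A}) := f (c (J j)) * ln (d (c (J j)))
  + \sum_(l | l != j) h (c (J j)) * (f (c (J l)) - w).
apply: (@le_trans _ _ (E G)); last first.
  rewrite /G code_meanD code_mean_sum.
  rewrite (code_mean_single hp (fun a => f a * ln (d a)) (J j)).
  rewrite [X in _ + X]big1 ?addr0 // => l lj.
  apply: (code_mean_centered hp h (g := fun a => f a - w)).
    by apply: contra lj => /eqP/J_inj ->.
  exact: sum_distr_centered.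
apply: ler_code_mean => // c _; rewrite /G.
set S := \sum_(l | l != j) f (c (J l)).
have S0 : 0 <= S by apply: sumr_ge0.
have -> : \sum_(l | l != j) h (c (J j)) * (f (c (J l)) - w)
     = h (c (J j)) * (S - (L.-1)%:R * w).
  rewrite -mulr_sumr sumrB sumr_const cardC1 card_ord; congr (_ * (_ - _)).
  by rewrite mulr_natl.
rewrite (bigD1 j) //= -/S.
set x := f (c (J j)).
have := f_ge0 (c (J j)); rewrite -/x le_eqVlt => /orP[/eqP x0|x0].
  by rewrite /h -/x -x0 !mul0r addr0.
have u0 : 0 < L%:R^-1 * (x + S) / w.
  by rewrite divr_gt0 // mulr_gt0 ?invr_gt0 // ltr_wpDr.
have := ler_wpM2l (ltW x0) (ln_le_tangent u0 (d0 (c (J j)))).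
move/le_trans; apply.
rewrite -addrA mulrDr lerD2l /h -/x.
have -> : (L.-1)%:R = L%:R - 1 :> R.
  by rewrite -subn1 natrB // (leq_ltn_trans _ (ltn_ord j)).
rewrite -subr_ge0.
(* The increase by [1 / L] of the tangent point is exactly the slack. *)
have -> : x / d (c (J j)) / (L%:R * w) * (S - (L%:R - 1) * w)
   - x * (L%:R^-1 * (x + S) / w / d (c (J j)) - 1) = x / d (c (J j)) / L%:R.
  rewrite /d -/x; field; rewrite !gt_eqF //=.
  by rewrite addr_gt0 ?mulr_gt0.
by rewrite !divr_ge0 ?f_ge0 // ltW.
Qed.

Hypothesis L_gt0 : (0 < L)%N.

(** Cross terms vanish by pairwise independence, and a variance is at most the second moment. *)
Lemma code_mean_var_avg (v : A -> R) :
  E (fun c => (L%:R^-1 * \sum_j v (c (J j)) - \sum_a p a * v a) ^+ 2) <=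
  L%:R^-1 * \sum_a p a * v a ^+ 2.
Proof.
have L0 : 0 < L%:R :> R by rewrite ltr0n.
set e := \sum_a p a * v a; pose u a := v a - e.
have u0 : \sum_a p a * u a = 0 by apply: sum_distr_centered.
pose G (c : {ffun K -> A}) :=
  (L%:R^-1) ^+ 2 * \sum_j \sum_l u (c (J j)) * u (c (J l)).
rewrite (@eq_code_mean _ _ _ _ _ G); last first.
  move=> c; rewrite /G -big_distrlr /= -expr2 -exprMn; congr (_ ^+ 2).
  rewrite sumrB sumr_const card_ord -[e *+ L]mulr_natl mulrBr.
  by rewrite mulrA mulVf ?mul1r // gt_eqF.
rewrite /G code_meanZ code_mean_sum.
rewrite [X in _ * X](eq_bigr (fun=> \sum_a p a * u a ^+ 2)); last first.
  move=> j _; rewrite code_mean_sum (bigD1 j) //= [X in _ + X]big1 ?addr0.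
    by rewrite (code_mean_single hp (fun a => u a * u a) (J j)).
  move=> l lj; apply: (code_mean_centered hp u (g := u)) => //.
  by apply: contra lj => /eqP/J_inj ->.
rewrite sumr_const card_ord -[X in _ * X <= _]mulr_natl expr2 -mulrA.
rewrite (mulrA L%:R^-1 L%:R) mulVf ?gt_eqF // mul1r.
rewrite ler_wpM2l ?invr_ge0 ?ler0n //.
have -> : \sum_a p a * u a ^+ 2 = \sum_a p a * v a ^+ 2 - e ^+ 2.
  transitivity (\sum_a (p a * v a ^+ 2 - p a * v a * (2 * e) + p a * e ^+ 2)).
    by apply: eq_bigr => a _; rewrite /u; ring.
  rewrite big_split sumrB /= -!mulr_suml (proj2 hp) -/e; ring.
by rewrite gerBl sqr_ge0.
Qed.

(* Values above the threshold [L * eta * w] are controlled in mean, the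
   others in variance. *)
Lemma code_mean_dist_avg (s eta : R) : 0 <= s <= 1 -> 0 < eta -> 0 < w ->
  E (fun c => `|avg c - w|) <=
  eta / 2 * w + ((L%:R * eta) `^ (1 - s) / (2 * L%:R * eta)
    + 2 * (L%:R * eta) `^ (- s)) * (\sum_a p a * (f a `^ (1 + s) * w `^ (- s))).
Proof.
move=> /andP[s0 s1] eta0 w0; have L0 : 0 < L%:R :> R by rewrite ltr0n.
have [p0 p1] := hp.
set th := L%:R * eta; have th0 : 0 < th by rewrite mulr_gt0.
have thw0 : 0 < th * w by rewrite mulr_gt0.
pose v a := if f a <= th * w then f a else 0.
pose u a := if f a <= th * w then 0 else f a.
have u_ge0 a : 0 <= u a by rewrite /u; case: ifP.
have fE a : f a = v a + u a by rewrite /v /u; case: ifP; rewrite ?addr0 ?add0r.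
pose ev := \sum_a p a * v a; pose eu := \sum_a p a * u a.
have wE : w = ev + eu.
  by rewrite /ev /eu -big_split; apply: eq_bigr => a _; rewrite fE mulrDr.
have eu0 : 0 <= eu by apply: sumr_ge0 => a _; rewrite mulr_ge0.
(* The scale for [norm_le_sqr]; it produces the term [eta / 2 * w]. *)
pose k := eta * w; have k0 : 0 < k by rewrite mulr_gt0.
pose m := \sum_a p a * (f a `^ (1 + s) * w `^ (- s)).
have f1s a : 0 < f a -> f a `^ (1 + s) = f a * f a `^ s.
  by move=> fa; rewrite powRD ?(gt_eqF fa) ?implybT // powRr1 // ltW.
(* Where [u] is nonzero, [f > th * w], so the factor [(f / (th * w)) ^ s] is at least [1]. *)
have eu_le : eu <= th `^ (- s) * m.
  rewrite /m mulr_sumr; apply: ler_sum => a _; rewrite [leRHS]mulrCA ler_wpM2l //.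
  rewrite mulrCA -(powRM _ (ltW th0) (ltW w0)); rewrite /u; case: (leP (f a) (th * w)) => [_|ta].
    by rewrite mulr_ge0 ?powR_ge0.
  have fa0 : 0 < f a by apply: lt_trans ta.
  rewrite f1s // powRN -mulrA; apply: ler_peMr => //.
  rewrite ler_pdivlMr ?powR_gt0 // mul1r.
  by rewrite ge0_ler_powR ?nnegrE ?(ltW thw0)// ltW.
(* Where [v] is nonzero, [f <= th * w], so in [f ^ 2 = f ^ (1 + s) * f ^ (1 - s)] the last factor is
   at most [(th * w) ^ (1 - s)]. *)
have v2_le : \sum_a p a * v a ^+ 2 <= th `^ (1 - s) * w * m.
  rewrite /m mulr_sumr; apply: ler_sum => a _; rewrite [leRHS]mulrCA ler_wpM2l //.
  have -> : th `^ (1 - s) * w * (f a `^ (1 + s) * w `^ (- s))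
     = f a `^ (1 + s) * (th * w) `^ (1 - s).
    rewrite (powRM _ (ltW th0) (ltW w0)) (powRD (r := 1) (s := - s) (x := w)).
      by rewrite (powRr1 (ltW w0)); ring.
    by rewrite (gt_eqF w0) ?implybT.
  rewrite /v; case: (leP (f a) (th * w)) => [ta|_]; last first.
    by rewrite expr0n /= mulr_ge0 ?powR_ge0.
  have := f_ge0 a; rewrite le_eqVlt => /orP[/eqP <-|fa].
    by rewrite expr0n /= mulr_ge0 ?powR_ge0.
  have -> : f a ^+ 2 = f a `^ (1 + s) * f a `^ (1 - s).
    rewrite -powRD ?(gt_eqF fa) ?implybT // -powR_mulrn ?ltW //.
    by congr (_ `^ _); lra.
  rewrite ler_wpM2l ?powR_ge0 // ge0_ler_powR ?nnegrE ?subr_ge0 //.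
  exact: ltW.
pose av (c : {ffun K -> A}) := L%:R^-1 * \sum_j v (c (J j)).
pose au (c : {ffun K -> A}) := L%:R^-1 * \sum_j u (c (J j)).
(* As [au] is nonnegative with mean [eu], its deviation costs at most [2 * eu] in mean. *)
pose G c := (2 * k)^-1 * (av c - ev) ^+ 2 + (k / 2 + eu + au c).
apply: (@le_trans _ _ (E G)).
  apply: ler_code_mean => // c _.
  have -> : avg c - w = (av c - ev) + (au c - eu).
    rewrite wE /av /au.
    under eq_bigr do rewrite fE.
    by rewrite big_split /=; ring.
  apply: le_trans (ler_normD _ _) _.
  have au0 : 0 <= au c.
    by rewrite mulr_ge0 ?sumr_ge0 // invr_ge0 ltW.
  have := norm_le_sqr (av c - ev) k0; rewrite (mulrC (_ ^+ 2)) /G.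
  have : `|au c - eu| <= au c + eu.
    by rewrite (le_trans (ler_normB _ _)) // !ger0_norm.
  lra.
have Eau : E au = eu.
  rewrite /au code_meanZ code_mean_sum (eq_bigr (fun=> eu)).
    rewrite sumr_const card_ord -[eu *+ L]mulr_natl mulrA mulVf ?mul1r //.
    by rewrite gt_eqF.
  by move=> j _; rewrite (code_mean_single hp u (J j)).
rewrite /G code_meanD code_meanZ (code_meanD p (fun=> k / 2 + eu) au).
rewrite code_mean_cst // Eau.
have h1 : (2 * k)^-1 * E (fun c => (av c - ev) ^+ 2) <=
    th `^ (1 - s) / (2 * L%:R * eta) * m.
  apply: (@le_trans _ _ ((2 * k)^-1 * (L%:R^-1 * (th `^ (1 - s) * w * m)))).
    apply: ler_wpM2l; first by rewrite invr_ge0 mulr_ge0 // ltW.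
    apply: le_trans (code_mean_var_avg v) _.
    by rewrite ler_wpM2l // invr_ge0 ltW.
  rewrite le_eqVlt; apply/orP; left; apply/eqP; rewrite /k; field.
  by rewrite !gt_eqF.
rewrite -/m /k in h1 *; move: h1 eu_le.
lra.
Qed.
End CodeMoments.

(** * Relative entropy and mixtures of output laws *)

Lemma rel_entE (R : realType) (C : finType) (a b : C -> R) :
  rel_ent a b = \sum_z a z * ln (a z / b z).
Proof. by apply: eq_bigr => z _; case: eqP => // ->; rewrite mul0r. Qed.

(** Gibbs' inequality, from [a * ln (a / b) >= a - b]. Without absolute continuity, the conventions
    [a / 0 = 0] and [ln 0 = 0] would hide an infinite term. *)
Lemma rel_ent_ge0 (R : realType) (C : finType) (a b : C -> R) :
  is_distr a -> is_distr b -> (forall z, b z = 0 -> a z = 0) -> 0 <= rel_ent a b.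
Proof.
move=> [a0 a1] [b0 b1] ab; rewrite rel_entE.
suff : \sum_z (a z - b z) <= \sum_z a z * ln (a z / b z).
  by rewrite sumrB a1 b1 subrr.
apply: ler_sum => z _.
have := a0 z; rewrite le_eqVlt => /orP[/eqP <-|az].
  by rewrite mul0r sub0r oppr_le0.
have bz : 0 < b z.
  rewrite lt_neqAle b0 andbT eq_sym; apply/eqP => /ab az0.
  by rewrite az0 ltxx in az.
have := ler_wpM2l (ltW az) (ln_le_tangent bz az).
rewrite ln_div ?posrE // !mulrDr mulrCA divff ?gt_eqF //; lra.
Qed.

Section Mixture.
Variables (R : realType) (C : finType) (M : nat) (a : 'I_M -> C -> R) (w : C -> R).
Hypothesis M_gt0 : (0 < M)%N.
Hypothesis a_distr : forall i, is_distr (a i).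
Hypothesis w_distr : is_distr w.
Local Notation mix z := (M%:R^-1 * \sum_i a i z).

Let M0 : 0 < M%:R :> R. Proof. by rewrite ltr0n. Qed.
Let MV0 : 0 <= M%:R^-1 :> R. Proof. by rewrite invr_ge0 ler0n. Qed.

Lemma mix_ge i z : M%:R^-1 * a i z <= mix z.
Proof.
rewrite ler_wpM2l ?MV0 // (bigD1 i) //= lerDl.
by apply: sumr_ge0 => j _; case: (a_distr j).
Qed.

Lemma mix_distr : is_distr (fun z => mix z).
Proof.
split=> [z|].
  by rewrite mulr_ge0 ?MV0 //; apply: sumr_ge0 => j _; case: (a_distr j).
rewrite -mulr_sumr exchange_big /= (eq_bigr (fun=> 1)); last first.
  by move=> i _; case: (a_distr i).
by rewrite sumr_const card_ord mulVf // gt_eqF.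
Qed.

Lemma mix_eq0 z : mix z = 0 -> forall i, a i z = 0.
Proof.
move=> m0 i; apply/eqP; rewrite eq_le (proj1 (a_distr i)) andbT.
by have := mix_ge i z; rewrite m0 pmulr_rle0 // invr_gt0.
Qed.

(** The mixture is at least [a i / M] pointwise, so the likelihood ratio is at most [M]. *)
Lemma rel_ent_mix_le_ln i : rel_ent (a i) (fun z => mix z) <= ln M%:R.
Proof.
have [a0 a1] := a_distr i.
have -> : ln M%:R = \sum_z a i z * ln M%:R :> R by rewrite -mulr_suml a1 mul1r.
rewrite rel_entE; apply: ler_sum => z _.
have := a0 z; rewrite le_eqVlt => /orP[/eqP <-|az]; first by rewrite !mul0r.
have Maz : 0 < M%:R^-1 * a i z by rewrite mulr_gt0 ?invr_gt0.
have mz : 0 < mix z by apply: lt_le_trans (mix_ge i z).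
rewrite ler_pM2l // ler_ln ?posrE ?divr_gt0 // ler_pdivrMr //.
by rewrite -ler_pdivrMl // mix_ge.
Qed.

(** The difference of the two sides is the divergence of the mixture from [w]. *)
Lemma mean_rel_ent_mix_le : (forall i z, w z = 0 -> a i z = 0) ->
  \sum_i M%:R^-1 * rel_ent (a i) (fun z => mix z) <=
  \sum_i M%:R^-1 * rel_ent (a i) w.
Proof.
move=> aw; rewrite -subr_ge0 -sumrB.
have -> : \sum_i (M%:R^-1 * rel_ent (a i) w
     - M%:R^-1 * rel_ent (a i) (fun z => mix z)) = rel_ent (fun z => mix z) w.
  rewrite [RHS]rel_entE.
  under [RHS]eq_bigr do rewrite -mulrA mulr_suml mulr_sumr.
  rewrite exchange_big /=; apply: eq_bigr => i _.
  rewrite -mulrBr !rel_entE -sumrB mulr_sumr; apply: eq_bigr => z _.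
  congr (_ * _); have := proj1 (a_distr i) z.
  rewrite le_eqVlt => /orP[/eqP <-|az]; first by rewrite !mul0r subrr.
  have wz : 0 < w z.
    rewrite lt_neqAle (proj1 w_distr) andbT eq_sym; apply/eqP => /aw az0.
    by rewrite az0 ltxx in az.
  have mz : 0 < mix z.
    by apply: lt_le_trans (mix_ge i z); rewrite mulr_gt0 ?invr_gt0.
  rewrite -mulrBr !ln_div ?posrE //; ring.
apply: rel_ent_ge0 => //; first exact: mix_distr.
by move=> z wz; rewrite big1 ?mulr0 // => i _; apply: aw.
Qed.

(** Triangle inequality through [w]; each index lies in [2 * (M - 1)] ordered pairs. *)
Lemma sum_dist_pair_le :
  (M%:R * (M%:R - 1))^-1 *
    (\sum_i \sum_(j | i != j) \sum_z `|a i z - a j z|) <=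
  2 * M%:R^-1 * \sum_i \sum_z `|a i z - w z|.
Proof.
pose D i := \sum_z `|a i z - w z|; rewrite -/D.
have D0 i : 0 <= D i by apply: sumr_ge0.
have [M1|M1] := leqP M 1%N.
  (* For [M = 1] the prefactor is [0^-1 = 0]. *)
  have -> : M%:R = 1 :> R by have -> : M = 1%N by case: (M) M_gt0 M1 => [|[]].
  rewrite subrr mulr0 invr0 mul0r invr1 mulr1; apply: mulr_ge0 => //.
  by apply: sumr_ge0 => i _; apply: D0.
have M10 : 0 < M%:R - 1 :> R by rewrite subr_gt0 ltr1n.
have -> : 2 * M%:R^-1 * (\sum_i D i) = (M%:R * (M%:R - 1))^-1 *
    (\sum_i \sum_(j | i != j) (D i + D j)).
  have -> : \sum_i \sum_(j | i != j) (D i + D j) = 2 * (M%:R - 1) * \sum_i D i.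
    under eq_bigr do rewrite big_split.
    rewrite big_split /= [X in _ + X](exchange_big_dep xpredT) //=.
    have cnt (i : 'I_M) (x : R) (Q : pred 'I_M) : Q =1 predC1 i ->
        \sum_(j | Q j) x = (M%:R - 1) * x.
      move=> QE; rewrite (eq_bigl _ _ QE) sumr_const cardC1 card_ord.
      by rewrite -[x *+ _]mulr_natl -subn1 natrB.
    rewrite (eq_bigr (fun i => (M%:R - 1) * D i)); last first.
      by move=> i _; apply: (cnt i) => j; rewrite /= eq_sym.
    rewrite [X in _ + X](eq_bigr (fun i => (M%:R - 1) * D i)); last first.
      by move=> i _; apply: (cnt i).
    by rewrite -mulr_sumr; ring.
  by field; rewrite !gt_eqF.
apply: ler_wpM2l; first by rewrite invr_ge0 mulr_ge0 ?ltW.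
apply: ler_sum => i _; apply: ler_sum => j _.
rewrite /D -big_split; apply: ler_sum => z _ /=.
by rewrite (distrC (a j z)) ler_distD.
Qed.

End Mixture.

(** * The random wire-tap code *)

Section RandomCode.
Variables (R : realType) (A B C : finType) (WB : A -> B -> R) (WE : A -> C -> R).
Variables (p : A -> R) (M L : nat).
Hypotheses (hWB : is_channel WB) (hWE : is_channel WE) (hp : is_distr p).
Hypotheses (M_gt0 : (0 < M)%N) (L_gt0 : (0 < L)%N).
Local Notation K := ('I_M * 'I_L)%type.
Implicit Type c : {ffun K -> A}.

(** Coinciding codewords count with multiplicity, so the output laws are plain averages over a
    row. *)
Definition unif_row c (i : 'I_M) (a : A) : R :=
  L%:R^-1 * \sum_j (c (i, j) == a)%:R.

(* Maximum likelihood decoding; ties are declared errors. *)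
Definition ml_region c (i : 'I_M) : {set B} :=
  [set b | [exists j, [forall k : K, (k.1 != i) ==> (WB (c k) b < WB (c (i, j)) b)]]].

Definition random_code c : wcode R A B := WCode (unif_row c) (ml_region c).

Let L0 : 0 < L%:R :> R. Proof. by rewrite ltr0n. Qed.
Let LV0 : 0 <= L%:R^-1 :> R. Proof. by rewrite invr_ge0 ler0n. Qed.
Let M0 : 0 < M%:R :> R. Proof. by rewrite ltr0n. Qed.
Let MV0 : 0 <= M%:R^-1 :> R. Proof. by rewrite invr_ge0 ler0n. Qed.

Lemma random_code_wcode c : is_wcode (random_code c).
Proof.
split => //; split => [i|i j ij].
  split=> [a|]; first by rewrite mulr_ge0 ?LV0 // sumr_ge0.
  rewrite -mulr_sumr exchange_big /= (eq_bigr (fun=> 1)).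
    by rewrite sumr_const card_ord mulVf // gt_eqF.
  move=> j _; rewrite (bigD1 (c (i, j))) //= eqxx big1 ?addr0 // => a ac.
  by rewrite eq_sym (negbTE ac).
(* At a common point, the winning codewords of the two rows would each be strictly more likely than
   the other. *)
rewrite disjoint_subset; apply/fintype.subsetP => b; rewrite !inE.
move=> /existsP[u /forallP Hu]; apply/negP => /existsP[v /forallP Hv].
have := Hu (j, v); have := Hv (i, u); rewrite /= ij eq_sym ij /= => h1 h2.
by have := lt_trans h1 h2; rewrite ltxx.
Qed.

Lemma chan_out_unif_row (D : finType) (W : A -> D -> R) c i z :
  chan_out W (unif_row c i) z = L%:R^-1 * \sum_j W (c (i, j)) z.
Proof.
rewrite /chan_out /unif_row.
under eq_bigr do rewrite -mulrA mulr_suml.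
rewrite -mulr_sumr exchange_big /=; congr (_ * _); apply: eq_bigr => j _.
rewrite (bigD1 (c (i, j))) //= eqxx mul1r big1 ?addr0 // => a ac.
by rewrite eq_sym (negbTE ac) mul0r.
Qed.
End RandomCode.

(** * The sums whose logarithms are [phiF] and [psiF] *)

Definition phi_sum (R : realType) (A B : finType) (W : A -> B -> R)
  (p : A -> R) (t : R) : R :=
  \sum_b (\sum_a p a * W a b `^ (1 + t)^-1) `^ (1 + t).

Definition psi_sum (R : realType) (A B : finType) (W : A -> B -> R)
  (p : A -> R) (s : R) : R :=
  \sum_a p a * \sum_b (W a b `^ (1 + s) * chan_out W p b `^ (- s)).

Lemma powRV (R : realType) (x s : R) : 0 <= x -> x^-1 `^ s = (x `^ s)^-1.
Proof. by move=> x0; rewrite -powR_inv1 // -powRrM mulN1r powRN. Qed.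

Lemma exists_distr_gt0 (R : realType) (A : finType) (p : A -> R) :
  is_distr p -> exists a, 0 < p a.
Proof.
move=> [p0 p1]; apply: contrapT => H; have : \sum_a p a = 0.
  apply: big1 => a _; apply/eqP; rewrite eq_le p0 andbT leNgt; apply/negP => pa.
  by apply: H; exists a.
by move/eqP; rewrite p1 oner_eq0.
Qed.

Section ChannelSums.
Variables (R : realType) (A B : finType) (W : A -> B -> R) (p : A -> R).
Hypotheses (hW : is_channel W) (hp : is_distr p).

Lemma chan_out_distr : is_distr (chan_out W p).
Proof.
split=> [b|]; first by apply: sumr_ge0 => a _; rewrite mulr_ge0 ?(proj1 hp)//; case: (hW a).
rewrite /chan_out exchange_big /= -[RHS](proj2 hp); apply: eq_bigr => a _.
by rewrite -mulr_sumr; case: (hW a) => _ ->; rewrite mulr1.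
Qed.

Lemma psi_sum_gt0 (s : R) : 0 < psi_sum W p s.
Proof.
have [p0 _] := hp; have [a pa] := exists_distr_gt0 hp.
have [b Wab] := exists_distr_gt0 (hW a).
have T0 a' b' : 0 <= W a' b' `^ (1 + s) * chan_out W p b' `^ (- s).
  by rewrite mulr_ge0 ?powR_ge0.
rewrite /psi_sum (bigD1 a) //= ltr_pwDl //; last first.
  by apply: sumr_ge0 => i _; rewrite mulr_ge0 ?sumr_ge0.
rewrite mulr_gt0 // (bigD1 b) //= ltr_pwDl ?sumr_ge0 //.
rewrite mulr_gt0 ?powR_gt0 // /chan_out (bigD1 a) //= ltr_pwDl ?mulr_gt0 //.
by apply: sumr_ge0 => i _; rewrite mulr_ge0 //; case: (hW i).
Qed.

Lemma phi_sum_gt0 (t : R) : 0 < phi_sum W p t.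
Proof.
have [p0 _] := hp; have [a pa] := exists_distr_gt0 hp.
have [b Wab] := exists_distr_gt0 (hW a).
rewrite /phi_sum (bigD1 b) //= ltr_pwDl ?sumr_ge0 // => [|i _]; last exact: powR_ge0.
rewrite powR_gt0 // (bigD1 a) //= ltr_pwDl ?mulr_gt0 ?powR_gt0 //.
by apply: sumr_ge0 => i _; rewrite mulr_ge0 ?powR_ge0.
Qed.

Lemma psi_sumE (s : R) : psi_sum W p s =
  \sum_b \sum_a p a * (W a b `^ (1 + s) * chan_out W p b `^ (- s)).
Proof. by rewrite exchange_big; apply: eq_bigr => a _; rewrite mulr_sumr. Qed.

(** Hoelder's inequality at each output: [W ^ r / S] and [W / w] have [p]-mean [1], hence so has
    their weighted arithmetic mean, which bounds the geometric one. The factor pulled out,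
    [S ^ (1 - s)], is the term of [phi_sum] at [- s]. *)
Lemma psi_sum_le_phi_sum (s : R) : 0 < s < 1 -> psi_sum W p s <= phi_sum W p (- s).
Proof.
move=> s01; have /andP[s0 s1] := s01; have [p0 p1] := hp.
have W0 a b : 0 <= W a b by case: (hW a).
have s1' : 0 < 1 - s by rewrite subr_gt0.
have sn : 1 - s != 0 by rewrite gt_eqF.
rewrite psi_sumE /phi_sum; apply: ler_sum => b _.
set w := chan_out W p b; set r := (1 - s)^-1.
set S := \sum_a p a * W a b `^ r.
have w0 : 0 <= w by apply: (proj1 chan_out_distr).
have T0 a : 0 <= p a * W a b `^ r by rewrite mulr_ge0 ?powR_ge0.
have r0 : r != 0 by rewrite invr_eq0.
have [wz|wn] := eqVneq w 0.
  (* By convention [0 ^ (- s) = 0] here, so the left side vanishes. *)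
  rewrite big1 ?powR_ge0 // => a _; rewrite wz powR0 ?mulr0 // oppr_eq0.
  by rewrite gt_eqF.
have wp : 0 < w by rewrite lt_neqAle eq_sym wn.
have Sp : 0 < S.
  rewrite lt_neqAle sumr_ge0 // andbT eq_sym; apply: contra wn => /eqP Sz.
  apply/eqP; apply: big1 => a _; have /eqP := psumr_eq0P (fun a _ => T0 a) Sz (i:=a) isT.
  rewrite mulf_eq0 => /orP[/eqP ->|]; first by rewrite mul0r.
  by rewrite powR_eq0 r0 andbT => /eqP ->; rewrite mulr0.
have key a : W a b `^ (1 + s) * w `^ (- s) <=
    S `^ (1 - s) * ((1 - s) * (W a b `^ r / S) + s * (W a b / w)).
  have -> : W a b `^ (1 + s) * w `^ (- s) =
      S `^ (1 - s) * ((W a b `^ r / S) `^ (1 - s) * (W a b / w) `^ s).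
    rewrite !powRM ?powR_ge0 ?invr_ge0 ?(ltW Sp) //.
    rewrite -powRrM mulVf // powRr1 // !powRV ?(ltW Sp) //.
    have -> : W a b `^ (1 + s) = W a b * W a b `^ s.
      by rewrite powRD ?powRr1 // gt_eqF // ltr_pwDl // ltW.
    rewrite powRN; field; rewrite !gt_eqF ?powR_gt0 //.
  apply: ler_wpM2l; first exact: powR_ge0.
  by rewrite powRM_le_convex // divr_ge0 ?powR_ge0 // ltW.
apply: (@le_trans _ _ (\sum_a p a *
   (S `^ (1 - s) * ((1 - s) * (W a b `^ r / S) + s * (W a b / w))))).
  by apply: ler_sum => a _; rewrite ler_wpM2l.
have -> : \sum_a p a * (S `^ (1 - s) * ((1 - s) * (W a b `^ r / S) + s * (W a b / w)))
  = S `^ (1 - s) * ((1 - s) / S * S + s / w * w).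
  rewrite {5}/S {3}/w /chan_out !mulr_sumr -big_split mulr_sumr.
  by apply: eq_bigr => a _; rewrite /=; ring.
by rewrite !divfK // ?gt_eqF // subrK mulr1.
Qed.

End ChannelSums.

(** * Mean performance of the random code *)

Section RandomCodeMean.
Variables (R : realType) (A B C : finType) (WB : A -> B -> R) (WE : A -> C -> R).
Variables (p : A -> R) (M L : nat).
Hypotheses (hWB : is_channel WB) (hWE : is_channel WE) (hp : is_distr p).
Hypotheses (M_gt0 : (0 < M)%N) (L_gt0 : (0 < L)%N).
Local Notation K := ('I_M * 'I_L)%type.
Local Notation E := (@code_mean R A K p).
Local Notation row c i z := (L%:R^-1 * \sum_j WE (c (i, j)) z).
Local Notation w := (chan_out WE p).
Implicit Type c : {ffun K -> A}.

Let L0 : 0 < L%:R :> R. Proof. by rewrite ltr0n. Qed.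
Let LV0 : 0 <= L%:R^-1 :> R. Proof. by rewrite invr_ge0 ler0n. Qed.
Let M0 : 0 < M%:R :> R. Proof. by rewrite ltr0n. Qed.
Let MV0 : 0 <= M%:R^-1 :> R. Proof. by rewrite invr_ge0 ler0n. Qed.
Let WB0 a b : 0 <= WB a b. Proof. by case: (hWB a). Qed.
Let WE0 a z : 0 <= WE a z. Proof. by case: (hWE a). Qed.

Lemma row_distr c i : is_distr (fun z => row c i z).
Proof. by apply: mix_distr => // j. Qed.

Lemma eps_B_random_code_ge0 c : 0 <= eps_B WB (random_code WB c).
Proof.
rewrite mulr_ge0 //; apply: sumr_ge0 => i _; apply: sumr_ge0 => b _.
by rewrite chan_out_unif_row mulr_ge0 ?sumr_ge0.
Qed.

(** Gallager's bound on the error event: with [r = 1 / (1 + s)] and [x] the likelihood of the sent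
    codeword, some codeword of another row is at least as likely, so the sum is at least [x ^ r],
    while [x = x ^ r * (x ^ r) ^ s]. *)
Lemma mul_error_indicator_le c (s : R) i j b : 0 <= s -> b \notin ml_region WB c i ->
  WB (c (i, j)) b <= WB (c (i, j)) b `^ (1 + s)^-1 *
    (\sum_(l | l != (i, j)) WB (c l) b `^ (1 + s)^-1) `^ s.
Proof.
move=> s0; set r := (1 + s)^-1; have r0 : 0 <= r by rewrite invr_ge0; lra.
rewrite inE negb_exists => /forallP /(_ j); rewrite negb_forall => /existsP[k].
rewrite negb_imply -leNgt => /andP[ki]; set x := WB (c (i, j)) b => xk.
have := WB0 (c (i, j)) b; rewrite -/x le_eqVlt => /orP[/eqP <-|x0].
  by rewrite mulr_ge0 ?powR_ge0.
have -> : x = x `^ r * (x `^ r) `^ s :> R.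
  rewrite -powRrM -powRD ?(gt_eqF x0) ?implybT //.
  have -> : r + r * s = 1 by rewrite /r; field; rewrite gt_eqF //; lra.
  by rewrite powRr1 // ltW.
have xr0 : 0 < x `^ r by exact: powR_gt0.
rewrite -powRrM.
(* The factorization of [x] was also substituted inside the power on the right; this restores it
   there. *)
have -> : (x `^ r * x `^ (r * s)) `^ r = x `^ r.
  rewrite -powRD ?(gt_eqF x0) ?implybT //.
  have -> : r + r * s = 1 by rewrite /r; field; rewrite gt_eqF //; lra.
  by rewrite powRr1 // ltW.
rewrite ler_pM2l // powRrM; apply: ge0_ler_powR => //; rewrite ?nnegrE.
- exact: ltW.
- by apply: sumr_ge0 => l _; exact: powR_ge0.
rewrite (bigD1 k) /=; last by apply: contra ki => /eqP ->.
apply: (@le_trans _ _ (WB (c k) b `^ r)).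
  by apply: ge0_ler_powR => //; rewrite ?nnegrE // ltW.
by rewrite lerDl; apply: sumr_ge0 => l _; exact: powR_ge0.
Qed.

(** For each codeword and output [b], the moment bound with [f = WB ^ r] gives [(M * L) ^ s] times
    the power [1 + s] of the mean of [f], which is the term of [phi_sum] at [b]. *)
Lemma code_mean_eps_B (s : R) : 0 <= s <= 1 ->
  E (fun c => eps_B WB (random_code WB c)) <=
  (M%:R * L%:R) `^ s * phi_sum WB p s.
Proof.
move=> s01; have /andP[s0 s1] := s01; set r := (1 + s)^-1.
have s1n : 0 < 1 + s by lra.
pose T c (k : K) b := WB (c k) b `^ r * (\sum_(l | l != k) WB (c l) b `^ r) `^ s.
have T0 c k b : 0 <= T c k b by rewrite mulr_ge0 ?powR_ge0.
pose G c := (M%:R * L%:R)^-1 * \sum_i \sum_j \sum_b T c (i, j) b.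
apply: (@le_trans _ _ (E G)).
  apply: ler_code_mean => // c _; rewrite /G invfM -mulrA ler_wpM2l //.
  rewrite mulr_sumr; apply: ler_sum => i _.
  under eq_bigr do rewrite chan_out_unif_row.
  rewrite -mulr_sumr ler_wpM2l // exchange_big /=; apply: ler_sum => j _.
  rewrite big_mkcond /=; apply: ler_sum => b _; rewrite finset.in_setC; case: ifP => // bD.
  exact: mul_error_indicator_le.
rewrite /G code_meanZ code_mean_sum.
apply: (@le_trans _ _ ((M%:R * L%:R)^-1 *
    \sum_(i < M) \sum_(j < L) ((M%:R * L%:R) `^ s * phi_sum WB p s))).
  apply: ler_wpM2l; first by rewrite invr_ge0 mulr_ge0 // ltW.
  apply: ler_sum => i _; rewrite code_mean_sum; apply: ler_sum => j _.
  rewrite code_mean_sum /phi_sum mulr_sumr; apply: ler_sum => b _.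
  have f0 a : 0 <= WB a b `^ r by exact: powR_ge0.
  apply: le_trans (code_mean_mul_powR_sum hp f0 (i, j) s01) _.
  rewrite card_prod !card_ord natrM.
  have g0 := distr_mean_ge0 hp f0.
  rewrite (powRM s (mulr_ge0 (ltW M0) (ltW L0)) g0) mulrCA -/r.
  by rewrite [X in _ * X <= _](_ : _ = (\sum_a p a * WB a b `^ r) `^ (1 + s)) //
     powRD ?powRr1 // gt_eqF.
rewrite !sumr_const !card_ord -[X in _ * X]mulr_natl -[X in _ * (_ * X)]mulr_natl.
by rewrite [X in _ * X]mulrA mulrA mulVf ?mul1r // mulf_neq0 // gt_eqF.
Qed.

Lemma I_E_random_codeE c : I_E WE (random_code WB c) =
  \sum_(i < M) M%:R^-1 * rel_ent (fun z => row c i z)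
    (fun z => M%:R^-1 * \sum_(i < M) row c i z).
Proof.
apply: eq_bigr => i _; congr (_ * _); rewrite !rel_entE; apply: eq_bigr => z _.
rewrite chan_out_unif_row; congr (_ * ln (_ / (_ * _))).
by apply: eq_bigr => j _; rewrite chan_out_unif_row.
Qed.

Lemma I_E_random_code_ge0 c : 0 <= I_E WE (random_code WB c).
Proof.
rewrite I_E_random_codeE; apply: sumr_ge0 => i _; rewrite mulr_ge0 //.
have rd j := row_distr c j.
apply: rel_ent_ge0 => //; first exact: mix_distr.
by move=> z mz; apply: (mix_eq0 M_gt0 rd mz).
Qed.

Lemma I_E_random_code_le_ln c : I_E WE (random_code WB c) <= ln M%:R.
Proof.
rewrite I_E_random_codeE -mulr_sumr ler_pdivrMl //.
have -> : M%:R * ln M%:R = \sum_(i < M) ln M%:R :> R.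
  by rewrite sumr_const card_ord mulr_natl.
by apply: ler_sum => i _; apply: rel_ent_mix_le_ln => // j; exact: row_distr.
Qed.

(** The output law [w] replaces that of the code, [code_mean_mul_ln_avg] bounds the mean of the
    logarithm, and [ln1D_le_powR] at [v = WE / (L * w)] yields the terms of [psi_sum]. *)
Lemma code_mean_I_E (s : R) : 0 < s <= 1 ->
  E (fun c => I_E WE (random_code WB c)) <= L%:R `^ (- s) * psi_sum WE p s / s.
Proof.
move=> s01; have /andP[s0 s1] := s01.
pose T c i j z := WE (c (i, j)) z * ln (row c i z / w z).
pose G c := M%:R^-1 * \sum_(i < M) L%:R^-1 * \sum_(j < L) \sum_z T c i j z.
apply: (@le_trans _ _ (E G)).
  apply: ler_code_mean => // c Pc; rewrite I_E_random_codeE.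
  apply: le_trans (mean_rel_ent_mix_le (w := w) M_gt0 _ _ _) _ => //.
  - by move=> i; exact: row_distr.
  - exact: chan_out_distr.
  (* An output null under [w] is null for every codeword of a codebook of positive probability. *)
  - move=> i z wz; rewrite big1 ?mulr0 // => j _.
    by apply: (code_prob_null hp (f := WE^~ z)).
  rewrite /G -mulr_sumr ler_wpM2l //; apply: ler_sum => i _.
  rewrite rel_entE [X in _ <= _ * X]exchange_big /= [leRHS]mulr_sumr; apply: ler_sum => z _.
  by rewrite /T -mulr_suml mulrA.
have key i j z : E (fun c => T c i j z) <= L%:R `^ (- s) / s *
    \sum_a p a * (WE a z `^ (1 + s) * w z `^ (- s)).
  have W0z a : 0 <= WE a z by [].
  have r0 : 0 <= L%:R `^ (- s) / s *
    \sum_a p a * (WE a z `^ (1 + s) * w z `^ (- s)).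
    rewrite mulr_ge0 ?divr_ge0 ?powR_ge0 ?(ltW s0) //; apply: sumr_ge0 => a _.
    by rewrite !mulr_ge0 ?powR_ge0 //; case: hp.
  have w0 : 0 <= w z by apply: (proj1 (chan_out_distr hWE hp)).
  move: (w0); rewrite le_eqVlt => /orP[/eqP wz|wz].
    apply: le_trans r0; rewrite -[leRHS](code_mean_cst [the finType of K] hp).
    apply: ler_code_mean => // c Pc.
    by rewrite /T (code_prob_null hp (i, j) W0z _ Pc) ?mul0r.
  have inj : injective (fun j : 'I_L => (i, j)) by move=> x y [].
  apply: le_trans (code_mean_mul_ln_avg hp W0z inj j wz) _.
  rewrite [leRHS]mulr_sumr; apply: ler_sum => a _; rewrite [leRHS]mulrCA.
  apply: ler_wpM2l; first by case: hp.
  rewrite -/(w z); have Lw : 0 < L%:R * w z by rewrite mulr_gt0.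
  have q0 : 0 <= WE a z / (L%:R * w z) by rewrite divr_ge0 // ltW.
  apply: le_trans (ler_wpM2l (W0z a) (ln1D_le_powR q0 s01)) _.
  rewrite powRM ?invr_ge0 ?(ltW Lw) // powRV ?(ltW Lw) // (powRM s (ltW L0) w0).
  rewrite !powRN powRD ?powRr1 //; last by rewrite gt_eqF //; lra.
  rewrite le_eqVlt; apply/orP; left; apply/eqP; field.
  by rewrite !gt_eqF ?powR_gt0.
rewrite /G code_meanZ code_mean_sum.
apply: (@le_trans _ _ (M%:R^-1 * \sum_(i < M) L%:R^-1 * \sum_(j < L)
   L%:R `^ (- s) / s * psi_sum WE p s)).
  apply: ler_wpM2l => //; apply: ler_sum => i _; rewrite code_meanZ.
  apply: ler_wpM2l => //; rewrite code_mean_sum; apply: ler_sum => j _.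
  by rewrite code_mean_sum psi_sumE mulr_sumr; apply: ler_sum => z _; exact: key.
rewrite !sumr_const !card_ord -[X in _ * X]mulr_natl -[X in _ * (_ * (_ * X))]mulr_natl.
rewrite le_eqVlt; apply/orP; left; apply/eqP; field.
by rewrite !gt_eqF.
Qed.

Lemma d_E_random_code_le c : d_E WE (random_code WB c) <=
  2 * M%:R^-1 * \sum_(i < M) \sum_z `|row c i z - w z|.
Proof.
apply: le_trans (sum_dist_pair_le (fun i z => row c i z) w M_gt0).
rewrite le_eqVlt; apply/orP; left; apply/eqP; congr (_ * _).
apply: eq_bigr => i _; apply: eq_bigr => j _; apply: eq_bigr => z _.
by rewrite !chan_out_unif_row.
Qed.

Lemma d_E_random_code_ge0 c : 0 <= d_E WE (random_code WB c).
Proof.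
rewrite mulr_ge0 //.
  by rewrite invr_ge0 mulr_ge0 // subr_ge0 ler1n.
by apply: sumr_ge0 => i _; apply: sumr_ge0 => j _; apply: sumr_ge0.
Qed.

Lemma code_mean_d_E (s : R) : 0 <= s <= 1 ->
  E (fun c => d_E WE (random_code WB c)) <=
  6 * (L%:R `^ (- s) * psi_sum WE p s) `^ (1 + s)^-1.
Proof.
move=> s01; have /andP[s0 s1] := s01.
have s1n : 0 < 1 + s by lra.
set Ps := psi_sum WE p s; have Ps0 : 0 < Ps by exact: psi_sum_gt0.
(* Chosen so that [L ^ (- s) * Ps = eta ^ (1 + s)], which makes every term of the truncation bound a
   multiple of [eta]. *)
set eta := _ `^ _; have eta0 : 0 < eta by rewrite powR_gt0 // mulr_gt0 ?powR_gt0.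
have PsE : Ps = L%:R `^ s * eta `^ (1 + s).
  rewrite /eta -powRrM mulVf ?gt_eqF // powRr1; last first.
    by rewrite mulr_ge0 ?powR_ge0 // ltW.
  by rewrite powRN mulrA divff ?mul1r // gt_eqF // powR_gt0.
set th := L%:R * eta; have th0 : 0 < th by rewrite mulr_gt0.
pose q := th `^ (1 - s) / (2 * L%:R * eta) + 2 * th `^ (- s).
have q0 : 0 <= q.
  by rewrite addr_ge0 ?divr_ge0 ?mulr_ge0 ?powR_ge0 ?(ltW L0) ?(ltW eta0).
(* The two terms of [q] contribute [eta / 2] and [2 * eta]. *)
have qPs : q * Ps = 5 / 2 * eta.
  have thE x : th `^ x = L%:R `^ x * eta `^ x by rewrite powRM ?ltW.
  have LE : L%:R `^ (1 - s) = L%:R / L%:R `^ s.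
    by rewrite powRD ?powRr1 ?powRN ?(ltW L0) ?(gt_eqF L0) ?implybT.
  have eE : eta `^ (1 - s) = eta / eta `^ s.
    by rewrite powRD ?powRr1 ?powRN ?(ltW eta0) ?(gt_eqF eta0) ?implybT.
  have eE' : eta `^ (1 + s) = eta * eta `^ s.
    by rewrite powRD ?powRr1 ?(ltW eta0) ?(gt_eqF eta0) ?implybT.
  rewrite PsE /q !thE LE eE eE' !powRN; field.
  by rewrite !(gt_eqF (powR_gt0 _ eta0)) !(gt_eqF (powR_gt0 _ L0)) !gt_eqF.
pose G c := 2 * M%:R^-1 * \sum_(i < M) \sum_z `|row c i z - w z|.
apply: (@le_trans _ _ (E G)).
  by apply: ler_code_mean => // c _; exact: d_E_random_code_le.
have key i z : E (fun c => `|row c i z - w z|) <= eta / 2 * w z +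
    q * \sum_a p a * (WE a z `^ (1 + s) * w z `^ (- s)).
  have W0z a : 0 <= WE a z by [].
  have w0 : 0 <= w z by apply: (proj1 (chan_out_distr hWE hp)).
  move: (w0); rewrite le_eqVlt => /orP[/eqP wz|wz].
    apply: (@le_trans _ _ 0); last first.
      rewrite addr_ge0 ?mulr_ge0 ?invr_ge0 ?(ltW eta0) //; apply: sumr_ge0 => a _.
      by rewrite !mulr_ge0 ?powR_ge0 //; case: hp.
    rewrite -[leRHS](code_mean_cst [the finType of K] hp).
    apply: ler_code_mean => // c Pc; rewrite -wz big1 ?mulr0 ?subr0 ?normr0 //.
    by move=> j _; apply: (code_prob_null hp (i, j) W0z _ Pc).
  have inj : injective (fun j : 'I_L => (i, j)) by move=> x y [].
  exact: (code_mean_dist_avg hp W0z inj L_gt0 s01 eta0 wz).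
rewrite /G code_meanZ code_mean_sum.
(* Here [3 = 1 / 2 + 5 / 2], as [w] sums to [1]; the factor [2] from pairs then gives [6]. *)
apply: (@le_trans _ _ (2 * M%:R^-1 * \sum_(i < M) (3 * eta))).
  apply: ler_wpM2l; first by rewrite mulr_ge0.
  apply: ler_sum => i _; rewrite code_mean_sum.
  apply: le_trans (ler_sum _ (fun z _ => key i z)) _.
  rewrite big_split /= -!mulr_sumr -psi_sumE -/Ps qPs.
  have [_ ->] := chan_out_distr hWE hp; lra.
rewrite sumr_const card_ord -[X in _ * X]mulr_natl.
rewrite le_eqVlt; apply/orP; left; apply/eqP; field.
by rewrite !gt_eqF.
Qed.

(** The code is compared with means that do not involve [s], hence one code for all [s];
    [18 = 3 * 6]. The bound by [ln M] serves the endpoint [t = 0], out of reach of the factor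
    [1 / s]. *)
Lemma exists_wcode : exists c : wcode R A B,
  [/\ wc_M c = M, is_wcode c,
      [/\ 0 <= eps_B WB c, 0 <= I_E WE c & 0 <= d_E WE c],
      I_E WE c <= ln M%:R &
      [/\ forall s, 0 <= s <= 1 ->
            eps_B WB c <= 3 * ((M%:R * L%:R) `^ s * phi_sum WB p s),
          forall s, 0 < s <= 1 ->
            I_E WE c <= 3 * (L%:R `^ (- s) * psi_sum WE p s / s) &
          forall s, 0 <= s <= 1 ->
            d_E WE c <= 18 * (L%:R `^ (- s) * psi_sum WE p s) `^ (1 + s)^-1]].
Proof.
have [c [_ c1 c2 c3]] := exists_le3_expect (code_prob_distr [the finType of K] hp)
  eps_B_random_code_ge0 I_E_random_code_ge0 d_E_random_code_ge0.
exists (random_code WB c); split => //.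
- exact: random_code_wcode.
- by split; [exact: eps_B_random_code_ge0 | exact: I_E_random_code_ge0
    | exact: d_E_random_code_ge0].
- exact: I_E_random_code_le_ln.
split=> s s01.
- by apply: le_trans c1 _; rewrite ler_pM2l // code_mean_eps_B.
- by apply: le_trans c2 _; rewrite ler_pM2l // code_mean_I_E.
- apply: le_trans c3 _; have := code_mean_d_E s01; rewrite /code_mean; lra.
Qed.

End RandomCodeMean.

(** * Single-letter form of the sums for memoryless extensions *)

Lemma powR_prod (R : realType) (I : finType) (f : I -> R) (r : R) :
  (forall i, 0 <= f i) -> (\prod_i f i) `^ r = \prod_i f i `^ r.
Proof.
move=> f0; suff [] : 0 <= \prod_i f i /\ (\prod_i f i) `^ r = \prod_i f i `^ r by [].
elim/big_rec2: _ => [|i y x _ [x0 <-]]; first by rewrite powR1.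
by split; [rewrite mulr_ge0 | rewrite powRM].
Qed.

Lemma sum_ffun_prod (R : realType) (B : finType) (n : nat) (g : B -> R) :
  \sum_(y : {ffun 'I_n -> B}) \prod_i g (y i) = (\sum_b g b) ^+ n.
Proof.
rewrite -(bigA_distr_bigA (fun _ : 'I_n => g)) /= prodr_const.
by rewrite card_ord.
Qed.

Section Extension.
Variables (R : realType) (A B : finType) (W : A -> B -> R) (p : A -> R) (n : nat).
Hypotheses (hW : is_channel W) (hp : is_distr p).
Local Notation Wn := (@ext_chan R n A B W).
Local Notation pn := (@code_prob R A [the finType of 'I_n] p).

Let W0 a b : 0 <= W a b. Proof. by case: (hW a). Qed.

Lemma ext_chan_channel : is_channel Wn.
Proof.
move=> x; split=> [y|]; first by apply: prodr_ge0.
rewrite -(bigA_distr_bigA (fun i b => W (x i) b)) /=.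
by apply: big1 => i _; case: (hW (x i)).
Qed.

(** Distributivity, the common source of the product formulas for the output law, [phi_sum] and
    [psi_sum]. *)
Lemma sum_code_prob_prod (g : A -> B -> R) (y : {ffun 'I_n -> B}) :
  \sum_x pn x * \prod_i g (x i) (y i) = \prod_i \sum_a p a * g a (y i).
Proof.
rewrite (bigA_distr_bigA (fun i a => p a * g a (y i))) /=.
by apply: eq_bigr => x _; rewrite big_split.
Qed.

Lemma chan_out_ext y : chan_out Wn pn y = \prod_i chan_out W p (y i).
Proof. exact: sum_code_prob_prod. Qed.

Lemma phi_sum_ext (t : R) : phi_sum Wn pn t = phi_sum W p t ^+ n.
Proof.
rewrite /phi_sum -sum_ffun_prod; apply: eq_bigr => y _.
rewrite (eq_bigr (fun x => pn x * \prod_i W (x i) (y i) `^ (1 + t)^-1)); last first.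
  by move=> x _; rewrite /ext_chan powR_prod.
rewrite (sum_code_prob_prod (fun a b => W a b `^ (1 + t)^-1)) powR_prod // => i.
by apply: sumr_ge0 => a _; rewrite mulr_ge0 ?powR_ge0 //; case: hp.
Qed.

Lemma psi_sum_ext (s : R) : psi_sum Wn pn s = psi_sum W p s ^+ n.
Proof.
rewrite !psi_sumE -sum_ffun_prod; apply: eq_bigr => y _.
rewrite -(sum_code_prob_prod (fun a b => W a b `^ (1 + s) * chan_out W p b `^ (- s))).
apply: eq_bigr => x _; rewrite big_split /= chan_out_ext /ext_chan !powR_prod // => i.
exact: (proj1 (chan_out_distr hW hp)).
Qed.

Lemma phi_sum0 : phi_sum W p 0 = 1.
Proof.
have [w0 w1] := chan_out_distr hW hp; rewrite -w1; apply: eq_bigr => b _.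
under eq_bigr do rewrite addr0 invr1 powRr1 //.
by rewrite addr0 powRr1 //; exact: w0.
Qed.

Lemma psi_sum0 : psi_sum W p 0 = 1.
Proof.
rewrite /psi_sum -[RHS](proj2 hp); apply: eq_bigr => a _.
under eq_bigr do rewrite oppr0 powRr0 mulr1 addr0 powRr1 //.
by case: (hW a) => _ ->; rewrite mulr1.
Qed.

End Extension.

(** * Exponential rates *)

Lemma limn_einf_ge (R : realType) (u : nat -> \bar R) (a : \bar R) (N : nat) :
  (forall n, (N <= n)%N -> (a <= u n)%E) -> (a <= limn_einf u)%E.
Proof.
move=> au; rewrite limn_einf_lim.
have := ereal_nondecreasing_cvgn (nondecreasing_einfs u).
move/cvg_lim => -> //.
apply: (@le_trans _ _ (einfs u N)); last by apply: ereal_sup_ubound; exists N.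
by apply/ereal_infP => _ [n /= Nn <-]; exact: au.
Qed.

(** The constant costs [ln C / n] in the rate, eventually below any [d > 0]. *)
Lemma neglog_rate_limn_einf_ge (R : realType) (x : nat -> R) (C e : R) : 0 < C ->
  (forall n, 0 <= x n) ->
  (forall n, (0 < n)%N -> x n <= C * expR (- (n%:R * e))) ->
  (e%:E <= limn_einf (neglog_rate x))%E.
Proof.
move=> C0 x0 xC; apply/lee_subgt0Pr => d d0.
(* Beyond [ln C / d]; the successor also excludes [n = 0]. *)
pose N := (Num.trunc (ln C / d)).+1.
apply: (limn_einf_ge (N := N)) => n Nn; rewrite /neglog_rate; case: eqP => [_|/eqP xn].
  exact: leey.
have {}xn : 0 < x n by rewrite lt_neqAle eq_sym xn x0.
have n0 : 0 < n%:R :> R by rewrite ltr0n (leq_trans _ Nn).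
rewrite -EFinB lee_fin ler_pdivlMr //.
have Cn : ln C < n%:R * d.
  rewrite -ltr_pdivrMr //; apply: lt_le_trans (truncnS_gt _) _.
  by rewrite ler_nat.
have : ln (x n) <= ln C - n%:R * e.
  have -> : ln C - n%:R * e = ln (C * expR (- (n%:R * e))).
    by rewrite lnM ?posrE ?expR_gt0 // expRK.
  by rewrite ler_ln ?posrE ?mulr_gt0 ?expR_gt0 // xC // -(ltr0n R).
move: Cn; nra.
Qed.

(** Passing to the next integer at most doubles the exponential, which is at least [1] as
    [r >= 0]. *)
Lemma exp_rate_size (R : realType) (r : R) (n : nat) : 0 <= r ->
  expR (n%:R * r) <= (Num.trunc (expR (n%:R * r))).+1%:R <= 2 * expR (n%:R * r).
Proof.
move=> r0; rewrite ltW ?truncnS_gt //=.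
have e1 : 1 <= expR (n%:R * r) by rewrite -expR0 ler_expR mulr_ge0.
have : (Num.trunc (expR (n%:R * r)))%:R <= expR (n%:R * r).
  by rewrite truncn_le expR_ge0.
rewrite -natr1; lra.
Qed.

(** The logarithm exceeds [n * r] by at most [ln 2 <= 1], so the error is at most [1 / n]. *)
Lemma ln_exp_rate_cvg (R : realType) (r : R) : 0 <= r ->
  (fun n : nat => ln ((Num.trunc (expR (n%:R * r))).+1%:R : R) / n%:R) @ \oo --> r.
Proof.
move=> r0; apply/cvgrPdist_le => /= e e0.
exists (Num.trunc (e^-1)).+1 => // n /= Nn.
have n0 : 0 < n%:R :> R by rewrite ltr0n (leq_trans _ Nn).
have en : 1 <= n%:R * e.
  rewrite -ler_pdivrMr // mul1r; apply: le_trans (ltW (truncnS_gt _)) _.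
  by rewrite ler_nat.
have /andP[Ml Mu] := exp_rate_size n r0.
set M := _.+1%:R in Ml Mu *.
have M0 : 0 < M by rewrite ltr0n.
have l1 : n%:R * r <= ln M by rewrite -[leLHS]expRK ler_ln ?posrE ?expR_gt0.
have l2 : ln M <= 1 + n%:R * r.
  apply: (@le_trans _ _ (ln (2 * expR (n%:R * r)))).
    by rewrite ler_ln ?posrE // mulr_gt0 // expR_gt0.
  rewrite lnM ?posrE ?expR_gt0 // expRK lerD2r.
  have : ln (1 + 1) <= 1 :> R by apply: le_ln1Dx; lra.
  by [].
have -> : r - ln M / n%:R = - ((ln M - n%:R * r) / n%:R).
  by field; rewrite gt_eqF.
rewrite normrN ger0_norm ?divr_ge0 ?subr_ge0 ?ler0n // ler_pdivrMr //.
nra.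
Qed.

Lemma exprn_expR_ln (R : realType) (x : R) (n : nat) : 0 < x ->
  x ^+ n = expR (n%:R * ln x).
Proof. by move=> x0; rewrite mulrC expRM lnK ?posrE // powR_mulrn // ltW. Qed.

Theorem theorem11 (R : realType) (X Y Z : finType)
  (WB : X -> Y -> R) (WE : X -> Z -> R)
  (hWB : is_channel WB) (hWE : is_channel WE)
  (Rt Rt' : R) (hR : 0 <= Rt) (hR' : 0 <= Rt')
  (p : X -> R) (hp : is_distr p) :
  exists Phi : forall n : nat, wcode R {ffun 'I_n -> X} {ffun 'I_n -> Y},
    (forall n, is_wcode (Phi n)) /\
    ((fun n : nat => ln ((wc_M (Phi n))%:R : R) / n%:R) @ \oo --> Rt) /\
    (ereal_sup [set (- phiF WB p s - s * (Rt + Rt'))%:E | s in `[0%R, 1%R]]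
       <= limn_einf (neglog_rate (fun n => eps_B (ext_chan WB) (Phi n))))%E /\
    (ereal_sup [set (- phiF WE p t - t * Rt')%:E | t in `[(- 2^-1)%R, 0%R]]
       <= limn_einf (neglog_rate (fun n => I_E (ext_chan WE) (Phi n))))%E /\
    (ereal_sup [set ((- psiF WE p s + s * Rt') / (1 + s))%:E | s in `[0%R, 1%R]]
       <= limn_einf (neglog_rate (fun n => d_E (ext_chan WE) (Phi n))))%E /\
    ((2^-1 : R)%:E * ereal_sup [set (- phiF WE p t - t * Rt')%:E | t in `[(- 2^-1)%R, 0%R]]
       <= limn_einf (neglog_rate (fun n => d_E (ext_chan WE) (Phi n))))%E.
Proof.
pose M n : nat := (Num.trunc (expR (n%:R * Rt))).+1.
pose L n : nat := (Num.trunc (expR (n%:R * Rt'))).+1.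
have ex n := @exists_wcode R _ _ _ (@ext_chan R n X Y WB) (@ext_chan R n X Z WE)
  (@code_prob R X [the finType of 'I_n] p) (M n) (L n)
  (@ext_chan_channel R X Y WB n hWB) (@ext_chan_channel R X Z WE n hWE)
  (code_prob_distr [the finType of 'I_n] hp)
  (ltn0Sn _) (ltn0Sn _).
pose Phi n := sval (cid (ex n)).
have PhiP n := svalP (cid (ex n)); rewrite -/(Phi _) in PhiP.
exists Phi.
have LB n : expR (n%:R * Rt') <= (L n)%:R <= 2 * expR (n%:R * Rt').
  exact: exp_rate_size.
have MB n : expR (n%:R * Rt) <= (M n)%:R <= 2 * expR (n%:R * Rt).
  exact: exp_rate_size.
have L0 n : 0 < (L n)%:R :> R by rewrite ltr0n.
have M0 n : 0 < (M n)%:R :> R by rewrite ltr0n.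
(* The power is negative, so the lower bound on [L] is the one needed. *)
have LN n s : 0 <= s -> (L n)%:R `^ (- s) <= expR (- (n%:R * (s * Rt'))).
  move=> s0; have /andP[Ll _] := LB n.
  rewrite powRN -(invrK (expR _)) -expRN opprK lef_pV2 ?posrE ?expR_gt0 ?powR_gt0 //.
  rewrite mulrA mulrAC expRM.
  by apply: ge0_ler_powR; rewrite ?nnegrE ?expR_ge0 // ltW.
pose lE := limn_einf (neglog_rate (fun n => d_E (@ext_chan R n X Z WE) (Phi n))).
have dE s : 0 <= s <= 1 ->
    (((- psiF WE p s + s * Rt') / (1 + s))%:E <= lE)%E.
  move=> s01; have /andP[s0 s1] := s01; have s1n : 0 < 1 + s by lra.
  apply: (@neglog_rate_limn_einf_ge _ _ 18) => // n.
    by have [_ _ [_ _ ?] _ _] := PhiP n.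
  move=> _; have [_ _ _ _ [_ _ /(_ s s01) H]] := PhiP n.
  apply: le_trans H _; rewrite ler_pM2l // psi_sum_ext //.
  rewrite (exprn_expR_ln _ (psi_sum_gt0 hWE hp s)).
  apply: (@le_trans _ _ ((expR (- (n%:R * (s * Rt')))
      * expR (n%:R * ln (psi_sum WE p s))) `^ (1 + s)^-1)).
    apply: ge0_ler_powR; rewrite ?nnegrE ?mulr_ge0 ?expR_ge0 ?powR_ge0 //.
      by rewrite invr_ge0 ltW.
    by rewrite ler_wpM2r ?expR_ge0 // LN.
  rewrite -expRD -expRM ler_expR le_eqVlt; apply/orP; left; apply/eqP.
  by rewrite /psiF -/(psi_sum _ _ _); field; rewrite gt_eqF.
have IE t : - 2^-1 <= t <= 0 -> ((- phiF WE p t - t * Rt')%:E <=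
    limn_einf (neglog_rate (fun n => I_E (@ext_chan R n X Z WE) (Phi n))))%E.
  (* At [t = 0] the claimed exponent is [0], and [ln M] grows at most linearly in [n]. *)
  move=> /andP[t1]; rewrite le_eqVlt => /orP[/eqP ->|t0].
    have -> : phiF WE p 0 = 0.
      by rewrite /phiF -/(phi_sum WE p 0) phi_sum0 // ln1.
    rewrite oppr0 mul0r subr0; apply/lee_subgt0Pr => d d0.
    rewrite sub0e.
    (* From [1 + n * Rt <= (1 + Rt) * n] and [n * d <= exp (n * d)]. *)
    apply: (@neglog_rate_limn_einf_ge _ _ ((1 + Rt) / d)).
    - by rewrite divr_gt0 //; lra.
    - by move=> n; have [_ _ [_ ? _] _ _] := PhiP n.
    move=> n n0; have [_ _ _ H _] := PhiP n; apply: le_trans H _.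
    have n1 : 1 <= n%:R :> R by rewrite ler1n.
    have /andP[Ml Mu] := MB n.
    have l2 : ln (M n)%:R <= 1 + n%:R * Rt :> R.
      apply: (@le_trans _ _ (ln (2 * expR (n%:R * Rt)))).
        by rewrite ler_ln ?posrE // mulr_gt0 // expR_gt0.
      rewrite lnM ?posrE ?expR_gt0 // expRK lerD2r.
      have : ln (1 + 1) <= 1 :> R by apply: le_ln1Dx; lra.
      by [].
    apply: le_trans l2 _; rewrite mulrN opprK.
    apply: (@le_trans _ _ ((1 + Rt) / d * (n%:R * d))).
      have -> : (1 + Rt) / d * (n%:R * d) = (1 + Rt) * n%:R.
        by field; rewrite gt_eqF.
      nra.
    apply: ler_wpM2l; first by rewrite divr_ge0 ?ltW //; lra.
    by apply: le_trans (expR_ge1Dx _); rewrite lerDr.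
  (* For fixed [t < 0] the factor [3 / s] does not depend on [n]. *)
  pose s := - t; have s0 : 0 < s by rewrite oppr_gt0.
  have s1 : s < 1 by rewrite /s; lra.
  have tE : t = - s by rewrite opprK.
  rewrite tE; apply: (@neglog_rate_limn_einf_ge _ _ (3 / s)).
  - by rewrite divr_gt0.
  - by move=> n; have [_ _ [_ ? _] _ _] := PhiP n.
  move=> n _; have [_ _ _ _ [_ /(_ s) + _]] := PhiP n.
  rewrite s0 (ltW s1) => /(_ isT) H; apply: le_trans H _.
  rewrite psi_sum_ext //.
  have h : psi_sum WE p s ^+ n <= expR (n%:R * phiF WE p (- s)).
    rewrite /phiF -/(phi_sum WE p (- s)) -exprn_expR_ln ?phi_sum_gt0 //.
    apply: lerXn2r; rewrite ?nnegrE.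
    - exact/ltW/psi_sum_gt0.
    - exact/ltW/phi_sum_gt0.
    by apply: psi_sum_le_phi_sum => //; rewrite s0.
  have -> : 3 / s * expR (- (n%:R * (- phiF WE p (- s) - - s * Rt'))) =
    3 * (expR (- (n%:R * (s * Rt'))) * expR (n%:R * phiF WE p (- s)) / s).
    rewrite -expRD [RHS]mulrA [RHS]mulrAC; congr (_ * expR _); ring.
  rewrite ler_pM2l // ler_pM2r ?invr_gt0 //.
  apply: ler_pM => //; rewrite ?powR_ge0 ?LN ?(ltW s0) //.
  by rewrite exprn_ge0 // ltW // psi_sum_gt0.
split; first by move=> n; have [_ ? _ _ _] := PhiP n.
split.
  rewrite (_ : (fun n => _) = (fun n => ln ((M n)%:R : R) / n%:R)); last first.
    by apply/funext => n; have [-> _ _ _ _] := PhiP n.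
  exact: ln_exp_rate_cvg.
split.
  apply: ge_ereal_sup => _ [s /= + <-]; rewrite in_itv /= => s01.
  have /andP[s0 s1] := s01.
  (* The [4] comes from the factor [2] in the upper bounds on [M] and on [L]. *)
  apply: (@neglog_rate_limn_einf_ge _ _ (3 * 4 `^ s)).
  - by rewrite mulr_gt0 // powR_gt0.
  - by move=> n; have [_ _ [? _ _] _ _] := PhiP n.
  move=> n _; have [_ _ _ _ [/(_ s s01) H _ _]] := PhiP n.
  apply: le_trans H _; rewrite phi_sum_ext // -mulrA ler_pM2l //.
  rewrite (exprn_expR_ln _ (phi_sum_gt0 hWB hp s)) -/(phiF _ _ _).
  have -> : - (n%:R * (- phiF WB p s - s * (Rt + Rt'))) =
    n%:R * (Rt + Rt') * s + n%:R * phiF WB p s by ring.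
  rewrite expRD mulrA ler_wpM2r ?expR_ge0 // expRM -powRM ?expR_ge0 //.
  apply: ge0_ler_powR; rewrite ?nnegrE ?mulr_ge0 ?expR_ge0 ?ler0n //.
  have /andP[_ Mu] := MB n; have /andP[_ Lu] := LB n.
  have -> : 4 * expR (n%:R * (Rt + Rt')) =
      (2 * expR (n%:R * Rt)) * (2 * expR (n%:R * Rt')) :> R.
    by rewrite mulrDr expRD; ring.
  by apply: ler_pM; rewrite ?ler0n.
split.
  by apply: ge_ereal_sup => _ [t /= + <-]; rewrite in_itv /=; exact: IE.
split.
  by apply: ge_ereal_sup => _ [s /= + <-]; rewrite in_itv /=; exact: dE.
(* With the factor [1 / 2] moved across, the supremum can be bounded term by term. *)
rewrite lee_pdivrMl //.
apply: ge_ereal_sup => _ [t /= + <-]; rewrite in_itv /= => /andP[t1 t0].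
rewrite -lee_pdivrMl // -EFinM.
(* The third bound at [s = 0]; it settles the case of a nonpositive exponent [y]. *)
have d0 : (0%:E <= lE)%E.
  have := dE 0; rewrite lexx ler01 => /(_ isT).
  rewrite mul0r addr0 /psiF -/(psi_sum WE p 0) psi_sum0 // ln1 oppr0 mul0r.
  exact.
set y := - phiF WE p t - t * Rt'.
have [y0|y0] := leP y 0.
  by apply: le_trans d0; rewrite lee_fin pmulr_rle0 // invr_gt0.
have tn : t < 0.
  rewrite lt_neqAle t0 andbT; apply/eqP => tz; move: y0.
  by rewrite /y tz /phiF -/(phi_sum WE p 0) phi_sum0 // ln1 oppr0 mul0r subr0 ltxx.
have s01 : 0 <= - t <= 1 by apply/andP; split; lra.
apply: le_trans (dE (- t) s01); rewrite lee_fin.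
have h : psiF WE p (- t) <= phiF WE p t.
  rewrite /psiF /phiF -/(phi_sum WE p t) -/(psi_sum WE p (- t)).
  rewrite ler_ln ?posrE ?psi_sum_gt0 ?phi_sum_gt0 //.
  have := @psi_sum_le_phi_sum _ _ _ WE p hWE hp (- t); rewrite opprK; apply.
  by apply/andP; split; lra.
(* With [s = - t], the numerator of the third exponent is at least [y > 0], and [1 + s <= 2]. *)
rewrite ler_pdivlMr; last lra.
move: y0; rewrite /y; nra.
Qed.
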